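(* Let $G$ be a completely metrizable topological group with identity $e$, let $d$ be a left-invariant compatible metric on $G$, let $\rho$ be a left-invariant continuous pseudometric on $G$, and let $T\colon G\to G$ be a continuous endomorphism of $G$. Then the following assertions are equivalent: (1) $T$ admits a dense set of irregular points; (2) $T$ admits a residual set of irregular points; (3) for every sequence $(O_j)_{j\in\mathbb{N}}$ of nonempty open subsets of $G$, there exists a sequence $(K_j)_{j\in\mathbb{N}}$ of Cantor sets with $K_j\subset O_j$ such that $\bigcup_{j=1}^\infty K_j$ is Li-Yorke extremely scrambled; (4) the proximal relation of $T$ is dense in $G\times G$ and $T$ is extremely sensitive.
   Context: A topological group is completely metrizable if its topology is induced by some complete metric. A compatible metric $d$ on $G$ is a metric inducing the topology of $G$ (not required to be complete). A (pseudo)metric $d$ is left-invariant if $d(zx,zy)=d(x,y)$ for all $x,y,z\in G$. A continuous endomorphism is a continuous group homomorphism $G\to G$. $\mathbb{N}$ is the set of positive integers. A set is residual if it contains a dense $G_\delta$ subset. A Cantor set is a subset homeomorphic to the Cantor ternary set. All ''extreme'' and ''irregular'' notions are with respect to the fixed $\rho$: A point $x\in G$ is irregular for $T$ if $\liminf_{n\to\infty} d(T^nx,e)=0$ and $\limsup_{n\to\infty} \rho(T^nx,e)=\infty$. A pair $(x,y)\in G\times G$ is Li-Yorke extremely chaotic if $\liminf_{n\to\infty}d(T^nx,T^ny)=0$ and $\limsup_{n\to\infty}\rho(T^nx,T^ny)=\infty$. A set $K\subset G$ is Li-Yorke extremely scrambled if any two distinct points of $K$ form a Li-Yorke extremely chaotic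 pair. The proximal relation of $T$ is $\{(x,y)\in G\times G: \liminf_{n\to\infty}d(T^nx,T^ny)=0\}$. $T$ is extremely sensitive if for every $x\in G$ and $\varepsilon>0$ there exist $y\in G$ with $d(x,y)<\varepsilon$ and $n\in\mathbb{N}$ such that $\rho(T^nx,T^ny)>\frac1\varepsilon$. *)

(* Defs.v *)
From HB Require Import structures.
From mathcomp Require Import all_boot all_order all_algebra.
From mathcomp Require Import all_classical all_reals all_analysis.
From mathcomp Require Import borel_hierarchy.

Set Implicit Arguments.
Unset Strict Implicit.
Unset Printing Implicit Defensive.

Import Order.TTheory GRing.Theory Num.Theory.
Import numFieldNormedType.Exports.

Local Open Scope classical_set_scope.
Local Open Scope ring_scope.

(* Multiplicative, possibly non-abelian; no separation axiom is included. *)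
HB.mixin Record isTopologicalGroup G of Topological G & monoid.Group G := {
  mulg_continuous : continuous (fun p : G * G => (p.1 * p.2)%g);
  invg_continuous : continuous (fun x : G => (x^-1)%g);
}.

#[short(type="topologicalGroupType")]
HB.structure Definition TopologicalGroup :=
  {G of Topological G & monoid.Group G & isTopologicalGroup G}.

Section Metrics.
Context {R : realType} {X : topologicalType}.
Implicit Type d : X -> X -> R.

Definition is_pseudometric d : Prop :=
  [/\ forall x y, 0 <= d x y,
      forall x, d x x = 0,
      forall x y, d x y = d y x &
      forall x y z, d x z <= d x y + d y z].

Definition is_metric d : Prop :=
  is_pseudometric d /\ forall x y, d x y = 0 -> x = y.

Definition induces_topology d : Prop :=
  forall (x : X) (A : set X),
    nbhs x A <-> exists2 e : R, 0 < e & [set y | d x y < e] `<=` A.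

Definition compatible_metric d : Prop := is_metric d /\ induces_topology d.

Definition cauchy_sequence d (u : nat -> X) : Prop :=
  forall e : R, 0 < e ->
    exists N : nat, forall m n : nat,
      (N <= m)%N -> (N <= n)%N -> d (u m) (u n) < e.

(* Stated for the ambient topology; the convergence is d-convergence once d
   induces that topology, as in completely_metrizable. *)
Definition complete_for d : Prop :=
  forall u : nat -> X, cauchy_sequence d u -> exists l : X, u @ \oo --> l.

Definition continuous_pseudometric d : Prop :=
  is_pseudometric d /\ continuous (fun p : X * X => d p.1 p.2).

End Metrics.

Definition completely_metrizable (R : realType) (X : topologicalType) : Prop :=
  exists d : X -> X -> R, compatible_metric d /\ complete_for d.

Definition left_invariant {R : realType} {G : topologicalGroupType}
    (d : G -> G -> R) : Prop :=
  forall x y z : G, d (z * x)%g (z * y)%g = d x y.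

Definition residual {X : topologicalType} (A : set X) : Prop :=
  exists D : set X, [/\ Gdelta D, dense D & D `<=` A].

(* Reals of the form \sum_(i >= 1) c_i / 3 ^ i with all digits c_i in {0, 2}. *)
Definition cantor_ternary_set {R : realType} : set R :=
  [set x : R | exists a : nat -> bool,
     series (fun i : nat => 2 * (a i)%:R / 3 ^+ i.+1 : R) @ \oo --> x].

Definition homeomorphic (X Y : topologicalType) : Prop :=
  exists (f : X -> Y) (g : Y -> X),
    [/\ continuous f, continuous g, cancel f g & cancel g f].

(* set_type carries the subspace topology. *)
Definition is_cantor_set (R : realType) {X : topologicalType} (K : set X) :
    Prop :=
  homeomorphic (set_type (@cantor_ternary_set R)) (set_type K).

Section Chaos.
Context {R : realType} {G : topologicalGroupType}.
Variables (d rho : G -> G -> R) (T : G -> G).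
Local Open Scope ereal_scope.

Definition irregular (x : G) : Prop :=
  limn_einf (fun n => (d (iter n T x) 1%g)%:E) = 0 /\
  limn_esup (fun n => (rho (iter n T x) 1%g)%:E) = +oo.

Definition proximal_relation : set (G * G) :=
  [set p | limn_einf (fun n => (d (iter n T p.1) (iter n T p.2))%:E) = 0].

Definition LY_extremely_chaotic (x y : G) : Prop :=
  limn_einf (fun n => (d (iter n T x) (iter n T y))%:E) = 0 /\
  limn_esup (fun n => (rho (iter n T x) (iter n T y))%:E) = +oo.

Definition LY_extremely_scrambled (K : set G) : Prop :=
  forall x y : G, K x -> K y -> x <> y -> LY_extremely_chaotic x y.

Definition extremely_sensitive : Prop :=
  forall (x : G) (eps : R), (0 < eps)%R ->
    exists (y : G) (n : nat),
      [/\ (d x y < eps)%R, (0 < n)%N &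
          (eps^-1 < rho (iter n T x) (iter n T y))%R].

End Chaos.

(* Main.v *)
Require Import Defs.
From HB Require Import structures.
From mathcomp Require Import all_boot all_order all_algebra.
From mathcomp Require Import all_classical all_reals all_analysis.
From mathcomp Require Import borel_hierarchy lra.

Set Implicit Arguments.
Unset Strict Implicit.
Unset Printing Implicit Defensive.

Import Order.TTheory GRing.Theory Num.Theory.
Import numFieldNormedType.Exports.

Local Open Scope classical_set_scope.
Local Open Scope ring_scope.

(** Left invariance of [d] and [rho] reduces statements about pairs to
statements about points: the distances between the orbits of [x] and [y] are
those between the orbit of [y^-1 * x] and the identity
([dist_iter_quotient]). So a pair is extremely chaotic iff [y^-1 * x] is
irregular, and proximal iff the orbit of [y^-1 * x] comes back near the
identity. Moreover a set [A] is dense in [G] iff its pullback along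
[(x, y) |-> y^-1 * x] is dense in [G * G] ([dense_left_quotient]).

The irregular points form a countable intersection of open sets, the k-th of
which asks for a return to within [1 / (k + 1)] of the identity at time [k] or
later and for a [rho]-excursion beyond [k] ([irregular_bigcap]). This settles
(1) <-> (2): as soon as irregular points are dense, they form a dense G_delta.

(2) -> (3) is an instance of Mycielski's theorem ([Mycielski]): in a completely
metrizable space, a G_delta dense relation which misses the diagonal contains
all pairs of distinct points of a union of Cantor sets, which can be placed in
prescribed open sets. The identity is a fixed point, hence not irregular, so
the relation of being extremely chaotic misses the diagonal.

(3) -> (4): Cantor sets placed in the two sides of an open box contain two
distinct points, one on each side, so chaotic pairs are dense in [G * G], and
irregular points are dense in [G]. Proximality is then dense a fortiori, and
multiplying [x] by an irregular point close to the identity produces the point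
required by extreme sensitivity at [x].

(4) -> (1): density of the proximal relation makes the set of points whose
orbits return near the identity dense. Sensitivity at the identity makes the
set of points with large excursions dense: a point with bounded orbit is
multiplied by a small element with a large excursion ([escapes_dense]). Both are G_delta sets,
and Baire's theorem applies.

Baire's theorem and Mycielski's theorem are both derived from Cantor's
intersection theorem for nested open sets ([nested_sets_meet]). *)

(** * Upper and lower limits of real sequences *)

(** Finitely many terms are bounded, so an unbounded real sequence is unbounded
along every tail. *)
Lemma limn_esup_pinftyP (R : realType) (u : nat -> R) :
  limn_esup (fun n => (u n)%:E) = +oo%E <-> forall M : R, exists n, M < u n.
Proof.
rewrite limn_esup_lim (cvg_lim _ (@cvg_esups_inf _ _))//; split=> [uoo M|uoo].
  have : (M%:E < esups (fun n => (u n)%:E) 0%N)%E.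
    have : (+oo <= esups (fun n => (u n)%:E) 0%N)%E.
      by rewrite -uoo; apply: ereal_inf_lbound; exists 0%N.
    by apply: lt_le_trans; rewrite ltry.
  by move=> /ereal_sup_gt[_ [/= n _ <-]]; rewrite lte_fin; exists n.
apply: le_anti; rewrite leey /=; apply: le_ereal_inf_tmp => _ [N _ <-].
rewrite (@eq_infty _ (esups _ N))// => M.
(* Exceeding the first [N] terms too forces the index past [N]. *)
have [n Mn] := uoo (Num.max M (\big[Num.max/0]_(i < N) u i)).
move: Mn; rewrite gt_max => /andP[Mn un].
have Nn : (N <= n)%N.
  rewrite leqNgt; apply/negP => nN; move: un; apply/negP; rewrite -leNgt.
  exact: (le_bigmax _ (fun i : 'I_N => u i) (Ordinal nN)).
apply: (@le_trans _ _ (u n)%:E); first by rewrite lee_fin ltW.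
by apply: ereal_sup_ubound; exists n.
Qed.

Lemma limn_einf_eq0P (R : realType) (u : nat -> R) : (forall n, 0 <= u n) ->
  limn_einf (fun n => (u n)%:E) = 0%E <->
  forall e : R, 0 < e -> forall N, exists2 n, (N <= n)%N & u n < e.
Proof.
move=> u0; rewrite limn_einf_lim (cvg_lim _ (@cvg_einfs_sup _ _))//.
split=> [ul0 e e0 N|ul0].
  have : (einfs (fun n => (u n)%:E) N < e%:E)%E.
    have : (einfs (fun n => (u n)%:E) N <= 0)%E.
      by rewrite -ul0; apply: ereal_sup_ubound; exists N.
    by move=> /le_lt_trans; apply; rewrite lte_fin.
  by move=> /ereal_inf_lt[_ [/= n Nn <-]]; rewrite lte_fin; exists n.
apply/eqP; rewrite eq_le; apply/andP; split.
  apply: ge_ereal_sup => _ [N _ <-].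
  apply/lee_addgt0Pr => e e0; rewrite add0e.
  have [n Nn une] := ul0 e e0 N.
  apply: (@le_trans _ _ (u n)%:E); last by rewrite lee_fin ltW.
  by apply: ereal_inf_lbound; exists n.
apply: (@le_trans _ _ (einfs (fun n => (u n)%:E) 0%N)).
  by apply: le_ereal_inf_tmp => _ [n _ <-]; rewrite lee_fin.
by apply: ereal_sup_ubound; exists 0%N.
Qed.

(** * Completely metrizable spaces *)

Section MetricTopology.
Context {R : realType} {X : topologicalType} {d : X -> X -> R}.
Hypothesis dX : compatible_metric d.

Lemma nbhs_metric_ball (x : X) (e : R) : 0 < e -> nbhs x [set y | d x y < e].
Proof. by move=> e0; apply/dX.2; exists e. Qed.

Lemma metric_ball_open (x : X) (e : R) : open [set y | d x y < e].
Proof.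
rewrite openE => y /= xy; apply/dX.2; exists (e - d x y); first by rewrite subr_gt0.
move=> z /=; rewrite ltrBrDl => h; apply: le_lt_trans h.
by case: dX => -[[_ _ _]].
Qed.

Lemma metrizable_hausdorff : hausdorff_space X.
Proof.
move=> p q pq; have [[[d0 dxx dC dT] dI] _] := dX; apply: dI.
apply/eqP; rewrite eq_le d0 andbT; apply/ler_addgt0Pr => e e0; rewrite add0r.
have e2 : 0 < e / 2 by rewrite divr_gt0.
have [y [/= py qy]] := pq _ _ (nbhs_metric_ball p e2) (nbhs_metric_ball q e2).
apply: (le_trans (dT p y q)); rewrite (dC y q); lra.
Qed.

(** The inductive step of all nested constructions below: the ball around a
point of [U], with radius at most half of [e] and half the radius of some ball
inside [U]. *)
Lemma shrink_open (U : set X) (e : R) : 0 < e -> open U -> U !=set0 ->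
  exists V : set X, [/\ open V, V !=set0, closure V `<=` U &
    forall y z, V y -> V z -> d y z < e].
Proof.
move=> e0 oU [x Ux]; have [[[d0 dxx dC dT] _] _] := dX.
have /dX.2[r r0 rU] : nbhs x U by exact: open_nbhs_nbhs.
pose s := Num.min (r / 2) (e / 2).
have s0 : 0 < s by rewrite lt_min !divr_gt0.
have [sr se] : s <= r / 2 /\ s <= e / 2 by split; rewrite ge_min lexx ?orbT.
exists [set y | d x y < s]; split; first exact: metric_ball_open.
- by exists x => /=; rewrite dxx.
- move=> y /(_ _ (nbhs_metric_ball y s0))[z [/= xz yz]]; apply: rU => /=.
  by have := dT x z y; rewrite (dC z y); lra.
- by move=> y z /= xy xz; have := dT y x z; rewrite (dC y x); lra.
Qed.

(** Cantor's intersection theorem, for sets which need not be closed: the limit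
of a choice of points lies in the closure of each set, hence in the previous
set. *)
Lemma nested_sets_meet (V : nat -> set X) : complete_for d ->
  (forall n, V n !=set0) -> (forall n, closure (V n.+1) `<=` V n) ->
  (forall n y z, V n.+1 y -> V n.+1 z -> d y z < n.+1%:R^-1) ->
  \bigcap_n V n !=set0.
Proof.
move=> dcomplete V0 VS Vd.
have Vle m n : (m <= n)%N -> V n `<=` V m.
  elim: n => [|n IH]; first by rewrite leqn0 => /eqP ->.
  rewrite leq_eqVlt => /orP[/eqP -> //|]; rewrite ltnS => /IH Vnm.
  by apply: subset_trans Vnm; exact: subset_trans (@subset_closure _ _) (VS n).
have /choice[u uV] : forall n, exists x, V n x by move=> n; exact: V0.
have [|l ul] := dcomplete u.
  move=> e e0; have [N Ne] : exists N : nat, N.+1%:R^-1 < e.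
    have [N _ /(_ N)] := near_infty_natSinv_lt (PosNum e0).
    by move=> /(_ (leqnn N)) /= NE; exists N.
  exists N.+1 => m n Nm Nn; apply: lt_trans Ne.
  by apply: Vd; [exact: Vle (uV m)|exact: Vle (uV n)].
exists l => n _; apply: VS => B /ul [N _ NB].
exists (u (maxn N n.+1)); split; last by apply: NB => /=; exact: leq_maxl.
exact: Vle (leq_maxr _ _) _ (uV _).
Qed.

End MetricTopology.

(** Successive shrinking: the n-th set is cut down into [W n] before it is shrunk,
and the point common to all these sets lies in [O] and in every [W n]. *)
Lemma Baire_completely_metrizable (R : realType) (X : topologicalType)
    (W : nat -> set X) : completely_metrizable R X ->
  (forall n, open (W n)) -> (forall n, dense (W n)) -> dense (\bigcap_n W n).
Proof.
move=> [d [dX dcomplete]] oW dW O O0 oO.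
(* The conditions are stated for all sets, so that a total choice function
   exists and can be iterated. *)
have step (nV : nat * set X) : exists V' : set X, open nV.2 -> nV.2 !=set0 ->
    [/\ open V', V' !=set0, closure V' `<=` nV.2 `&` W nV.1 &
        forall y z, V' y -> V' z -> d y z < nV.1.+1%:R^-1].
  case: nV => n V /=.
  have [[oV V0]|nV] := pselect (open V /\ V !=set0); last first.
    by exists set0 => oV V0; case: nV.
  have e0 : 0 < n.+1%:R^-1 :> R by rewrite invr_gt0.
  have [V' V'P] := shrink_open dX e0 (openI oV (oW n)) (dW n _ V0 oV).
  by exists V'.
have [next nextP] := choice step.
pose V := fix V n := if n is m.+1 then next (m, V m) else O.
have VP n : open (V n) /\ V n !=set0.
  by elim: n => [//|n [oV V0]]; case: (nextP (n, V n) oV V0).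
have [|n|n|x Vx] := @nested_sets_meet _ _ _ V dcomplete.
- by move=> n; case: (VP n).
- have [_ _ VW _] := nextP (n, V n) (VP n).1 (VP n).2.
  by move=> x /VW[].
- by have [_ _ _] := nextP (n, V n) (VP n).1 (VP n).2.
exists x; split; first exact: (Vx 0%N).
move=> n _; have [_ _ VW _] := nextP (n, V n) (VP n).1 (VP n).2.
by apply: (VW x _).2; apply: subset_closure; exact: (Vx n.+1).
Qed.

(** * Cantor sets as images of the space of binary sequences *)

Lemma homeomorphic_sym (X Y : topologicalType) :
  homeomorphic X Y -> homeomorphic Y X.
Proof. by move=> [f [g [cf cg fK gK]]]; exists g, f. Qed.

Lemma homeomorphic_trans (X Y Z : topologicalType) :
  homeomorphic X Y -> homeomorphic Y Z -> homeomorphic X Z.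
Proof.
move=> [f [g [cf cg fK gK]]] [f' [g' [cf' cg' fK' gK']]].
exists (f' \o f), (g \o g'); split; [| |exact: can_comp|exact: can_comp].
- by move=> x; apply: continuous_comp; [exact: cf|exact: cf'].
- by move=> x; apply: continuous_comp; [exact: cg'|exact: cg].
Qed.

(** A continuous injection from a compact space to a Hausdorff space maps closed
sets to closed sets, so its inverse is continuous on the range. *)
Lemma homeomorphic_range_compact (K X : topologicalType) (f : K -> X) :
  compact [set: K] -> hausdorff_space X -> continuous f -> injective f ->
  homeomorphic K (set_type (range f)).
Proof.
move=> cK hX cf injf.
have fP x : f x \in range f by apply/mem_set; exists x.
have /choice[g gP] : forall y : set_type (range f), exists x, f x = \val y.
  by case=> y yP; have [x _ xy] := set_mem yP; exists x.
pose F x : set_type (range f) := exist _ (f x) (fP x).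
have FK : cancel F g by move=> x; apply: injf; rewrite gP.
have gK : cancel g F by move=> y; apply: val_inj; rewrite /= gP.
exists F, g; split => //.
  by apply/continuousP => _ [B oB <-]; apply: (open_comp (f := f)) => // x _; exact: cf.
apply/continuous_closedP => A cA.
have cfA : closed (f @` A).
  apply: (compact_closed hX); apply: continuous_compact.
    exact: continuous_subspaceT.
  exact: subclosed_compact cA cK (fun _ _ => I).
have -> : g @^-1` A = set_val @^-1` (f @` A).
  apply/seteqP; split => y /=.
    by move=> Ay; exists (g y).
  by case=> x Ax; rewrite set_valE -gP => /injf <-.
by move/continuous_closedP : (@initial_continuous (set_type (range f)) X set_val); apply.
Qed.

Lemma nbhs_prefix (a : cantor_space) (n : nat) :
  nbhs a [set b : cantor_space | forall i, (i < n)%N -> b i = a i].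
Proof.
elim: n => [|n IH]; first by apply: filterS filterT => b _ i.
have bn : nbhs a [set b : cantor_space | b n = a n].
  have /(_ [set a n]) := @proj_continuous _ (fun _ : nat => bool) n a.
  by apply; exact: discrete_set1.
near=> b => i; rewrite ltnS leq_eqVlt => /orP[/eqP ->|].
  by near: b.
by move: i; near: b.
Unshelve. all: by end_near. Qed.

Section TernaryExpansion.
Context {R : realType}.
Implicit Type a b : cantor_space.

Let digit a (i : nat) : R := 2 * (a i)%:R / 3 ^+ i.+1.
Let psum a (n : nat) : R := series (digit a) n.

Let psumS a n : psum a n.+1 = psum a n + digit a n.
Proof. by rewrite /psum -seriesSr seriesEnat. Qed.

Let digit_ge0 a n : 0 <= digit a n.
Proof. by rewrite !mulr_ge0// invr_ge0 exprn_ge0. Qed.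

Let digit_le a n : digit a n <= 2 / 3 ^+ n.+1.
Proof.
rewrite ler_pM2r ?invr_gt0 ?exprn_gt0// ler_piMr//.
by case: (a n).
Qed.

Let psum_le a : {homo psum a : m n / (m <= n)%N >-> m <= n}.
Proof.
by apply/nondecreasing_seqP => n; rewrite psumS lerDl.
Qed.

(** All the later digits together contribute at most [3 ^- m]. *)
Let psum_tail a m n : (m <= n)%N ->
  psum a n + 3 ^- n <= psum a m + 3 ^- m.
Proof.
elim: n => [|n IH]; first by rewrite leqn0 => /eqP ->.
rewrite leq_eqVlt => /orP[/eqP -> //|]; rewrite ltnS => /IH; apply: le_trans.
rewrite psumS -addrA lerD2l; have := digit_le a n.
have -> : 3 ^- n = 3 / 3 ^+ n.+1 :> R by rewrite exprS invfM mulrA divff ?mul1r.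
lra.
Qed.

Let psum_cvg a : cvgn (psum a).
Proof.
apply: nondecreasing_is_cvgn; first exact: psum_le.
exists 1 => _ [n _ <-]; have := psum_tail a (leq0n n).
have -> : psum a 0 = 0 by rewrite /psum seriesEnat /= big_geq.
rewrite expr0 invr1.
have : 0 < 3 ^- n :> R by rewrite invr_gt0 exprn_gt0.
lra.
Qed.

Definition ternary_sum a : R := limn (psum a).

Let psum_le_sum a n : psum a n <= ternary_sum a.
Proof. exact: nondecreasing_cvgn_le (@psum_le a) (@psum_cvg a) n. Qed.

Let sum_le_psum a n : ternary_sum a <= psum a n + 3 ^- n.
Proof.
apply: limr_le; first exact: psum_cvg.
exists n => //= m /= nm; have := psum_tail a nm.
have : 0 < 3 ^- m :> R by rewrite invr_gt0 exprn_gt0.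
lra.
Qed.

Let eq_psum a b n : (forall i, (i < n)%N -> b i = a i) -> psum b n = psum a n.
Proof.
move=> ab; rewrite /psum !seriesEord /=; apply: eq_bigr => i _.
by rewrite /digit ab.
Qed.

(** At the first digit where two sequences differ, the sums are separated by
[2 / 3 ^ (n + 1)], more than what the remaining digits can make up for. *)
Lemma ternary_sum_inj : injective ternary_sum.
Proof.
move=> a b ab; apply/funext => n; have [n0 n0n] := ubnP n.
elim: n0 n n0n => // n0 IH n; rewrite ltnS => nn0.
have pre : psum b n = psum a n.
  by apply: eq_psum => i ilt; rewrite IH// (leq_trans ilt).
have u := psum_le_sum a n.+1; have v := psum_le_sum b n.+1.
have u' := sum_le_psum a n.+1; have v' := sum_le_psum b n.+1.
move: u u' v v'; rewrite ab !psumS pre /digit.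
have : 0 < 3 ^- n.+1 :> R by rewrite invr_gt0 exprn_gt0.
by case: (a n); case: (b n) => //=; lra.
Qed.

Lemma ternary_sum_continuous : continuous ternary_sum.
Proof.
move=> a; apply/cvgrPdist_lt => e e0.
have [n ne] : exists n : nat, 3 ^- n < e.
  have z1 : `|3^-1| < 1 :> R by rewrite ger0_norm ?invr_ge0// invf_lt1// ltr1n.
  have /cvgrPdist_lt/(_ e e0)[n _ /(_ n (leqnn n))] := cvg_expr z1.
  rewrite /= sub0r normrN ger0_norm ?exprn_ge0 ?invr_ge0// exprVn => ne.
  by exists n.
apply: filterS (nbhs_prefix a n) => b /eq_psum ab.
have := psum_le_sum a n; have := psum_le_sum b n.
have := sum_le_psum a n; have := sum_le_psum b n.
rewrite ab ltr_norml; lra.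
Qed.

Lemma range_ternary_sum : range ternary_sum = cantor_ternary_set.
Proof.
apply/seteqP; split=> [_ [a _ <-]|x [a ax]].
  by exists a; exact: psum_cvg.
by exists a => //; apply/cvg_lim.
Qed.

End TernaryExpansion.

(** The space of binary sequences is the model of the Cantor set used in the
constructions; [ternary_sum] identifies it with the ternary set. *)
Lemma is_cantor_set_range (R : realType) (X : topologicalType)
    (f : cantor_space -> X) : hausdorff_space X -> continuous f ->
  injective f -> is_cantor_set R (range f).
Proof.
move=> hX cf injf; apply: (@homeomorphic_trans _ cantor_space).
  apply: homeomorphic_sym; rewrite -range_ternary_sum.
  apply: homeomorphic_range_compact cantor_space_compact _ _ _.
  - exact: Rhausdorff.
  - exact: ternary_sum_continuous.
  - exact: ternary_sum_inj.
exact: homeomorphic_range_compact cantor_space_compact hX cf injf.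
Qed.

Lemma cantor_set_two_points (R : realType) (X : topologicalType) (K : set X) :
  is_cantor_set R K -> exists x y, [/\ K x, K y & x <> y].
Proof.
move=> [f [g [_ _ fK _]]].
have tP a : @ternary_sum R a \in cantor_ternary_set.
  by apply/mem_set; rewrite -range_ternary_sum; exists a.
pose t a : set_type (@cantor_ternary_set R) := exist _ (ternary_sum a) (tP a).
exists (\val (f (t (fun=> true)))), (\val (f (t (fun=> false)))).
split; [exact: set_valP|exact: set_valP|].
move=> /val_inj /(can_inj fK) /(congr1 \val) /= /ternary_sum_inj.
by move=> /(congr1 (@^~ 0%N)).
Qed.

(** * Mycielski's theorem *)

Lemma open_setX_subset (X Y : topologicalType) (O : set (X * Y)) :
  open O -> O !=set0 -> exists U V, [/\ open U, open V, U !=set0, V !=set0 &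
    U `*` V `<=` O].
Proof.
move=> oO [[x y] Oxy]; have : nbhs (x, y) O by exact: open_nbhs_nbhs.
case=> -[A B] /= []; rewrite !nbhsE => -[U [oU Ux] UA] [V [oV Vy] VB] ABO.
exists U, V; split => //; [by exists x|by exists y|].
by move=> p [/UA ? /VB ?]; apply: ABO.
Qed.

Lemma open_setX (X Y : topologicalType) (U : set X) (V : set Y) :
  open U -> open V -> open (U `*` V).
Proof.
move=> oU oV; rewrite openE => -[x y] [/= Ux Vy].
by exists (U, V) => //; split; exact: open_nbhs_nbhs.
Qed.

Lemma open_dense_bigcap_prefix (X : topologicalType) (W : nat -> set X) :
  (forall n, open (W n)) -> (forall n, dense (W n)) -> forall n,
  open (\bigcap_(k in `I_n) W k) /\ dense (\bigcap_(k in `I_n) W k).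
Proof.
move=> oW dW; elim=> [|n [oWn dWn]].
  by rewrite II0 bigcap_set0; split; [exact: openT|move=> O; rewrite setIT].
rewrite IIS bigcap_setU bigcap_set1; split; first exact: openI.
exact: denseI.
Qed.

(** The pairs of [L] are treated one after the other. Each one only shrinks the
sets at two indices, and a shrinking preserves what the earlier pairs
achieved. *)
Lemma shrink_pairs (X : topologicalType) (I : eqType) (W : set (X * X))
    (L : seq (I * I)) (S : I -> set X) :
  open W -> dense W -> (forall i, open (S i) /\ S i !=set0) ->
  exists S' : I -> set X,
    [/\ forall i, open (S' i) /\ S' i !=set0, forall i, S' i `<=` S i &
        forall i j, (i, j) \in L -> i != j -> S' i `*` S' j `<=` W].
Proof.
move=> oW dW SP; elim: L => [|[a b] L [S1 [S1P S1S S1W]]].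
  by exists S; split => // i.
have [->|ab] := eqVneq a b.
  exists S1; split => // i j; rewrite inE => /orP[/eqP[-> ->]|]; first by rewrite eqxx.
  exact: S1W.
have [] := @open_setX_subset _ _ (S1 a `*` S1 b `&` W).
- by apply: openI => //; apply: open_setX; [exact: (S1P a).1|exact: (S1P b).1].
- apply: dW; last by apply: open_setX; [exact: (S1P a).1|exact: (S1P b).1].
  by have [x ?] := (S1P a).2; have [y ?] := (S1P b).2; exists (x, y).
move=> U [V [oU oV U0 V0 UV]].
have Ua : U `<=` S1 a.
  by have [y Vy] := V0; move=> x Ux; have [[]] := UV (x, y) (conj Ux Vy).
have Vb : V `<=` S1 b.
  by have [x Ux] := U0; move=> y Vy; have [[]] := UV (x, y) (conj Ux Vy).
pose S2 i := if i == a then U else if i == b then V else S1 i.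
have S21 i : S2 i `<=` S1 i.
  by rewrite /S2; case: eqP => [->//|_]; case: eqP => [->//|_].
exists S2; split.
- by move=> i; rewrite /S2; case: eqP => // _; case: eqP.
- by move=> i; apply: subset_trans (S21 i) (S1S i).
move=> i j; rewrite inE => /orP[/eqP[-> ->] _|ijL ij].
  rewrite /S2 eqxx [b == a]eq_sym (negbTE ab) eqxx.
  by move=> p /UV[].
by move=> p [/S21 ? /S21 ?]; apply: (S1W _ _ ijL ij).
Qed.

(** A Cantor scheme with countably many roots: [S n (j, s)] is an open set attached
to the word [s] of length [n] above the root [j], and [f j a] is the point common
to the sets attached to the prefixes of [a]. Stage [n + 1] puts the product of
any two of its sets with distinct indices and roots at most [n] inside the first
[n] relations. Two distinct branches have distinct indices from some stage on,
hence their limit points satisfy all the relations. Bounding the roots by the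
stage keeps the number of pairs to be treated finite. *)
Lemma Mycielski_scheme (R : realType) (X : topologicalType)
    (W : nat -> set (X * X)) (O : nat -> set X) :
  completely_metrizable R X ->
  (forall n, open (W n)) -> (forall n, dense (W n)) ->
  (forall j, open (O j)) -> (forall j, O j !=set0) ->
  exists f : nat -> cantor_space -> X,
    [/\ forall j, continuous (f j), forall j a, O j (f j a) &
        forall i j a b, (i, a) <> (j, b) -> (\bigcap_n W n) (f i a, f j b)].
Proof.
move=> [d [dX dcomplete]] oW dW oO O0.
pose I := (nat * seq bool)%type.
pose good (S : I -> set X) := forall i, open (S i) /\ S i !=set0.
pose WI n := \bigcap_(k in `I_n) W k.
have step (nS : nat * (I -> set X)) : exists S' : I -> set X, good nS.2 ->
    [/\ good S', forall j s, closure (S' (j, s)) `<=` nS.2 (j, take nS.1 s),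
        forall i y z, S' i y -> S' i z -> d y z < nS.1.+1%:R^-1 &
        forall i j (s t : nS.1.+1.-tuple bool), (i <= nS.1)%N -> (j <= nS.1)%N ->
          (i, tval s) != (j, tval t) ->
          S' (i, tval s) `*` S' (j, tval t) `<=` WI nS.1].
  case: nS => n S /=.
  have [Sgood|] := pselect (good S); last by exists S.
  have [oWn dWn] := open_dense_bigcap_prefix oW dW n.
  pose L : seq I := [seq (i, tval s) | i <- iota 0 n.+1, s <- enum {: n.+1.-tuple bool}].
  pose S0 (i : I) := S (i.1, take n i.2).
  have [|S1 [S1good S10 S1W]] :=
    @shrink_pairs _ _ _ [seq (p, q) | p <- L, q <- L] S0 oWn dWn.
    by move=> i; exact: Sgood.
  have e0 : 0 < n.+1%:R^-1 :> R by rewrite invr_gt0.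
  have /choice[S2 S2P] i := shrink_open dX e0 (S1good i).1 (S1good i).2.
  have S21 i : S2 i `<=` S1 i.
    by apply: subset_trans (@subset_closure _ _) _; case: (S2P i).
  exists S2 => _; split.
  - by move=> i; case: (S2P i).
  - by move=> j s; case: (S2P (j, s)) => _ _ h _; apply: subset_trans h (S10 _).
  - by move=> i; case: (S2P i).
  move=> i j s t iN jN ij p [/S21 pi /S21 pj].
  apply: (S1W (i, tval s) (j, tval t)) => //.
  by apply: allpairs_f; apply: (allpairs_f (fun i (s : n.+1.-tuple bool) => (i, tval s)));
    rewrite ?mem_iota ?mem_enum.
have [next nextP] := choice step.
pose S := fix S n := if n is m.+1 then next (m, S m) else fun i => O i.1.
have Sgood n : good (S n).
  by elim: n => [i|n Sn]; [split; [exact: oO|exact: O0]|case: (nextP (n, S n) Sn)].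
have fP (ja : nat * cantor_space) : exists x, forall n, S n (ja.1, mkseq ja.2 n) x.
  case: ja => j a /=.
  have [|n|n|x Sx] := @nested_sets_meet _ _ _ (fun n => S n (j, mkseq a n)) dcomplete.
  - by move=> n; case: (Sgood n (j, mkseq a n)).
  - have [_ + _ _] := nextP (n, S n) (Sgood n).
    move=> /(_ j (mkseq a n.+1)) /=.
    by rewrite /mkseq -map_take take_iota (minn_idPl _).
  - have [_ _ + _] := nextP (n, S n) (Sgood n); exact.
  by exists x => n; exact: Sx.
have [f fS] := choice fP.
exists (fun j a => f (j, a)); split.
- move=> j a A /dX.2[e e0 eA].
  have [n _ /(_ n (leqnn n)) /= ne] := near_infty_natSinv_lt (PosNum e0).
  apply: filterS (nbhs_prefix a n.+1) => b ab; apply: eA => /=; apply: lt_trans ne.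
  have [_ _ + _] := nextP (n, S n) (Sgood n).
  move=> /(_ (j, mkseq a n.+1)); apply; first exact: (fS (j, a) n.+1).
  rewrite (_ : mkseq a n.+1 = mkseq b n.+1); first exact: (fS (j, b) n.+1).
  by apply/eq_in_map => i; rewrite mem_iota /= => /ab.
- by move=> j a; exact: (fS (j, a) 0%N).
move=> i j a b iajb k _.
have [N Nab] : exists N, forall n, (N <= n)%N ->
    (i, mkseq a n.+1) != (j, mkseq b n.+1).
  have [ij|ij] := eqVneq i j; last first.
    by exists 0%N => n _; rewrite xpair_eqE negb_and ij.
  have [N abN] : exists N, a N <> b N.
    apply/existsNP => ab; apply: iajb; rewrite ij; congr pair; exact/funext.
  exists N => n Nn; rewrite xpair_eqE negb_and; apply/orP; right.
  apply/negP => /eqP /(congr1 (nth true ^~ N)) /=.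
  by rewrite !nth_mkseq.
(* A stage at which both roots are active, the [k]-th relation is enforced, and
   the two prefixes differ. *)
pose n := maxn (maxn i j) (maxn k.+1 N).
have [_ _ _] := nextP (n, S n) (Sgood n).
have sz (c : cantor_space) : size (mkseq c n.+1) == n.+1 by rewrite size_mkseq.
move=> /(_ i j (Tuple (sz a)) (Tuple (sz b))) /=; apply.
- by rewrite /n !leq_max leqnn.
- by rewrite /n !leq_max leqnn orbT.
- by apply: Nab; rewrite /n !leq_max leqnn !orbT.
- by split; [exact: (fS (i, a) n.+1)|exact: (fS (j, b) n.+1)].
by rewrite /= /n !leq_max leqnn !orbT.
Qed.

(** Because the relation misses the diagonal, the maps given by the scheme are
injective, so that their ranges are Cantor sets. *)
Lemma Mycielski (R : realType) (X : topologicalType)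
    (W : nat -> set (X * X)) (O : nat -> set X) :
  completely_metrizable R X ->
  (forall n, open (W n)) -> (forall n, dense (W n)) ->
  (forall x, ~ (\bigcap_n W n) (x, x)) ->
  (forall j, open (O j)) -> (forall j, O j !=set0) ->
  exists K : nat -> set X,
    [/\ forall j, is_cantor_set R (K j), forall j, K j `<=` O j &
        forall x y, (\bigcup_j K j) x -> (\bigcup_j K j) y -> x <> y ->
          (\bigcap_n W n) (x, y)].
Proof.
move=> cX oW dW Wdiag oO O0.
have [f [cf fO fW]] := Mycielski_scheme cX oW dW oO O0.
exists (fun j => range (f j)); split.
- move=> j; apply: is_cantor_set_range => //.
    by have [d [dX _]] := cX; exact: metrizable_hausdorff dX.
  move=> a b fab; apply: contrapT => ab; apply: (Wdiag (f j a)).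
  by rewrite {2}fab; apply: fW => -[].
- by move=> j _ [a _ <-]; exact: fO.
move=> _ _ [i _ [a _ <-]] [j _ [b _ <-]] fab; apply: fW => -[ij aeb].
by apply: fab; rewrite ij aeb.
Qed.

(** * Quotients in topological groups *)

Lemma dense_subset (X : topologicalType) (A B : set X) :
  A `<=` B -> dense A -> dense B.
Proof. by move=> AB dA O O0 oO; have [x [Ox /AB]] := dA O O0 oO; exists x. Qed.

Section LeftQuotient.
Context {G : topologicalGroupType}.

Lemma left_quotient_continuous : continuous (fun p : G * G => (p.2^-1 * p.1)%g).
Proof.
move=> p; apply: (@continuous_comp _ _ _ (fun p : G * G => (p.2^-1%g, p.1))
  (fun p : G * G => (p.1 * p.2)%g)); last exact: mulg_continuous.
apply: cvg_pair; last exact: cvg_fst.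
apply: (@continuous_comp _ _ _ snd (fun x : G => x^-1%g)); first exact: cvg_snd.
exact: invg_continuous.
Qed.

Lemma left_translation_continuous (y : G) : continuous (fun z : G => (y * z)%g).
Proof.
move=> z; apply: (@continuous_comp _ _ _ (fun z : G => (y, z))
  (fun p : G * G => (p.1 * p.2)%g)); last exact: mulg_continuous.
by apply: cvg_pair; [exact: cvg_cst|exact: cvg_id].
Qed.

(** One direction holds because the quotient map is continuous and onto; the
other because, with [y] fixed, the points [y^-1 * x] for [x] in an open set form
an open set. *)
Lemma dense_left_quotient (A : set G) :
  dense [set p : G * G | A (p.2^-1 * p.1)%g] <-> dense A.
Proof.
split=> [dA O [z Oz] oO|dA O O0 oO].
  have [] := dA ((fun p : G * G => (p.2^-1 * p.1)%g) @^-1` O).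
  - by exists (z, 1%g); rewrite /= invg1 mul1g.
  - by apply: open_comp => // p _; exact: left_quotient_continuous.
  by move=> p [/= Op Ap]; exists (p.2^-1 * p.1)%g.
have [U [V [oU oV [x Ux] [y Vy] UV]]] := open_setX_subset oO O0.
have [] := dA ((fun z : G => y * z)%g @^-1` U).
- by exists (y^-1 * x)%g; rewrite /= mulVKg.
- by apply: open_comp => // p _; exact: left_translation_continuous.
move=> z [/= Uz Az]; exists ((y * z)%g, y); split; first exact: UV.
by rewrite /= mulKg.
Qed.

End LeftQuotient.

(** * Orbits of a continuous endomorphism *)

Section Dynamics.
Context {R : realType} {G : topologicalGroupType}.
Variables (d rho : G -> G -> R) (T : {multiplicative G -> G}).
Hypothesis d_compatible : compatible_metric d.
Hypothesis d_left : left_invariant d.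
Hypothesis rho_cont : continuous_pseudometric rho.
Hypothesis rho_left : left_invariant rho.
Hypothesis T_cont : continuous T.

Let d_ge0 x y : 0 <= d x y. Proof. by have [[[]]] := d_compatible. Qed.

Let iter_continuous n : continuous (iter n T).
Proof.
elim: n => [|n IH] x; first exact: cvg_id.
by apply: continuous_comp; [exact: IH|exact: T_cont].
Qed.

Let iter_mul n x y : iter n T (x * y)%g = (iter n T x * iter n T y)%g.
Proof. by elim: n => //= n ->; rewrite gmulfM. Qed.

Let iter_quotient n x y :
  iter n T (y^-1 * x)%g = ((iter n T y)^-1 * iter n T x)%g.
Proof. by apply: (mulgI (iter n T y)); rewrite -iter_mul !mulVKg. Qed.

Let iter1 n : iter n T 1%g = 1%g.
Proof. by apply: (mulgI (iter n T 1%g)); rewrite -iter_mul !mulg1. Qed.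

(** This is where left invariance and multiplicativity of [T] turn the joint
behaviour of two orbits into the behaviour of one. *)
Lemma dist_iter_quotient (e : G -> G -> R) (x y : G) : left_invariant e ->
  (fun n => (e (iter n T (y^-1 * x)%g) 1%g)%:E) =
  (fun n => (e (iter n T x) (iter n T y))%:E).
Proof.
move=> eL; apply/funext => n.
by rewrite iter_quotient -(eL _ _ (iter n T y)) mulVKg mulg1.
Qed.

Definition returns_near_identity (k : nat) : set G :=
  \bigcup_(n in [set n | (k <= n)%N]) [set z | d 1%g (iter n T z) < k.+1%:R^-1].

Definition escapes (k : nat) : set G :=
  \bigcup_n [set z | k%:R < rho (iter n T z) 1%g].

Lemma returns_near_identity_open k : open (returns_near_identity k).
Proof.
apply: bigcup_open => n _.
apply: (open_comp (D := [set y | d 1%g y < k.+1%:R^-1])).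
  by move=> z _; exact: iter_continuous.
exact: metric_ball_open.
Qed.

Lemma escapes_open k : open (escapes k).
Proof.
apply: bigcup_open => n _.
apply: (open_comp (f := fun z => rho (iter n T z) 1%g) (D := [set r | k%:R < r])).
  move=> z _.
  apply: (@continuous_comp _ _ _ (fun z => (iter n T z, 1%g : G))
    (fun p : G * G => rho p.1 p.2)); last exact: rho_cont.2.
  by apply: cvg_pair; [exact: iter_continuous|exact: cvg_cst].
exact: open_gt.
Qed.

Lemma proximal_identityP z :
  limn_einf (fun n => (d (iter n T z) 1%g)%:E) = 0%E <->
  (\bigcap_k returns_near_identity k) z.
Proof.
have [[[_ _ dC _] _] _] := d_compatible.
rewrite limn_einf_eq0P//; split=> [zP k _|zP e e0 N].
  have [|n kn nk] := zP k.+1%:R^-1 _ k; first by rewrite invr_gt0.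
  by exists n => //=; rewrite dC.
have [k _ ke] := near_infty_natSinv_lt (PosNum e0).
have [n /= mn nm] := zP (maxn k N) I.
exists n; first by apply: leq_trans mn; exact: leq_maxr.
by rewrite dC; apply: lt_trans nm _; apply: ke => /=; exact: leq_maxl.
Qed.

Lemma unboundedP z :
  limn_esup (fun n => (rho (iter n T z) 1%g)%:E) = +oo%E <->
  (\bigcap_k escapes k) z.
Proof.
rewrite limn_esup_pinftyP; split=> [zP k _|zP M].
  by have [n kn] := zP k%:R; exists n.
have [n _ /= Mn] := zP (Num.truncn M).+1 I.
by exists n; apply: lt_trans Mn; exact: truncnS_gt.
Qed.

Definition irregular_stage (k : nat) : set G :=
  returns_near_identity k `&` escapes k.

Lemma irregular_bigcap : irregular d rho T = \bigcap_k irregular_stage k.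
Proof.
rewrite bigcapI; apply/seteqP; split=> z [].
  by move=> /proximal_identityP ? /unboundedP.
by split; [exact/proximal_identityP|exact/unboundedP].
Qed.

Lemma proximal_relationE : proximal_relation d T =
  [set p | (\bigcap_k returns_near_identity k) (p.2^-1 * p.1)%g].
Proof.
by apply/seteqP; split=> p /=;
  rewrite /proximal_relation /= -proximal_identityP dist_iter_quotient.
Qed.

Lemma LY_extremely_chaoticE x y :
  LY_extremely_chaotic d rho T x y = irregular d rho T (y^-1 * x)%g.
Proof. by rewrite /irregular !dist_iter_quotient. Qed.

Lemma LY_extremely_chaotic_relationE :
  [set p | LY_extremely_chaotic d rho T p.1 p.2] =
  [set p | irregular d rho T (p.2^-1 * p.1)%g].
Proof. by apply/seteqP; split=> p /=; rewrite LY_extremely_chaoticE. Qed.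

Lemma irregular_stage_open k : open (irregular_stage k).
Proof. exact: openI (returns_near_identity_open k) (escapes_open k). Qed.

Lemma identity_not_irregular : ~ irregular d rho T 1%g.
Proof.
rewrite irregular_bigcap => /(_ 0%N I)[_ [n _]] /=.
by rewrite iter1; have [[_ -> _ _] _] := rho_cont; rewrite ltxx.
Qed.

(** Multiplying [x] by an irregular point [z] close to the identity moves the orbit
of [x] by exactly the excursions of [z]. *)
Lemma dense_irregular_sensitive :
  dense (irregular d rho T) -> extremely_sensitive d rho T.
Proof.
move=> dI x eps eps0; have [_ rxx rC _] := rho_cont.1.
have d0 y : d y y = 0 by case: d_compatible => -[[]].
have [||z [/= dz [_ /limn_esup_pinftyP zoo]]] := dI [set y | d 1%g y < eps].
- by exists 1%g; rewrite /= d0.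
- exact: metric_ball_open.
(* The second bound rules out [n = 0]. *)
have [n] := zoo (Num.max eps^-1 (rho z 1%g)).
rewrite gt_max => /andP[nz n0].
exists (x * z)%g, n; split.
- by rewrite -{1}[x]mulg1 d_left.
- by case: n n0 {nz} => //=; rewrite ltxx.
by rewrite iter_mul rC -{2}[iter n T x]mulg1 rho_left.
Qed.

(** If the orbit of [z] does not itself leave the ball of radius [k] around the
identity, multiplying [z] by a small [y] with an excursion larger than [2 k]
makes it leave that ball. *)
Lemma escapes_dense k : extremely_sensitive d rho T -> dense (escapes k).
Proof.
move=> sens O [z Oz] oO; have [_ _ rC rT] := rho_cont.1.
have [[n kn]|bnd] := pselect (exists n, k%:R < rho (iter n T z) 1%g).
  by exists z; split => //; exists n.
have /d_compatible.2[e e0 eO] : nbhs z O by exact: open_nbhs_nbhs.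
(* [r] small enough for [z * y] to stay in [O], and for the excursion of [y] to
   exceed [2 k + 1]. *)
pose r := Num.min e (k%:R + k%:R + 1)^-1.
have r0 : 0 < r by rewrite lt_min e0 invr_gt0 ltr_wpDl// -natrD.
have [y [n [dy _ ny]]] := sens 1%g r r0.
exists (z * y)%g; split.
  apply: eO => /=; rewrite -{1}[z]mulg1 d_left.
  by apply: lt_le_trans dy _; rewrite ge_min lexx.
exists n => //=; rewrite iter_mul.
have zk : rho (iter n T z) 1%g <= k%:R.
  by rewrite leNgt; apply/negP => zk; apply: bnd; exists n.
have rk : k%:R + k%:R + 1 <= r^-1.
  by rewrite -[leLHS]invrK lef_pV2 ?posrE ?invr_gt0 ?ltr_wpDl// ?ge_min ?lexx ?orbT// -natrD.
have yE : rho (iter n T z * iter n T y)%g (iter n T z) = rho 1%g (iter n T y).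
  by rewrite -{2}[iter n T z]mulg1 rho_left rC.
have := rT (iter n T z * iter n T y)%g 1%g (iter n T z).
rewrite yE (rC 1%g (iter n T z)); rewrite iter1 in ny; lra.
Qed.

(** Both conditions defining irregularity are G_delta, so that Baire's theorem
combines their densities. *)
Lemma dense_irregular (G_complete : completely_metrizable R G) :
  dense (proximal_relation d T) -> extremely_sensitive d rho T ->
  dense (irregular d rho T).
Proof.
rewrite proximal_relationE dense_left_quotient => dP sens.
rewrite irregular_bigcap; apply: (Baire_completely_metrizable G_complete).
  exact: irregular_stage_open.
move=> k; apply: denseI (returns_near_identity_open k) _ (escapes_dense k sens).
by apply: dense_subset _ dP => z; apply.
Qed.

End Dynamics.

(** * The equivalence *)

Theorem theorem3p24 (R : realType) (G : topologicalGroupType)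
    (d rho : G -> G -> R) (T : {multiplicative G -> G})
    (G_complete : completely_metrizable R G)
    (d_compatible : compatible_metric d)
    (d_left : left_invariant d)
    (rho_cont : continuous_pseudometric rho)
    (rho_left : left_invariant rho)
    (T_cont : continuous T) :
  [<-> (exists A : set G, dense A /\ A `<=` irregular d rho T);
       (exists A : set G, residual A /\ A `<=` irregular d rho T);
       (forall O : nat -> set G,
          (forall j, open (O j)) -> (forall j, O j !=set0) ->
          exists K : nat -> set G,
            [/\ forall j, is_cantor_set R (K j),
                forall j, K j `<=` O j &
                LY_extremely_scrambled d rho T (\bigcup_j K j)]);
       (dense (proximal_relation d T) /\ extremely_sensitive d rho T)].
Proof.
have irrE := irregular_bigcap rho T d_compatible.
have oI := irregular_stage_open d_compatible rho_cont T_cont.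
tfae.
- move=> [A [dA AI]]; exists (irregular d rho T); split => //.
  exists (irregular d rho T); split => //; last exact: dense_subset AI dA.
  by rewrite irrE; exists (irregular_stage d rho T).
- move=> [A [[D [_ dD DA]] AI]] O oO O0.
  have dI : dense (irregular d rho T).
    exact: dense_subset (subset_trans DA AI) dD.
  pose W n := (fun p : G * G => (p.2^-1 * p.1)%g) @^-1` irregular_stage d rho T n.
  have WE p : (\bigcap_n W n) p = irregular d rho T (p.2^-1 * p.1)%g.
    by rewrite irrE.
  have [n|n|x|K [KC KO KW]] := @Mycielski R G W O G_complete _ _ _ oO O0.
  + apply: open_comp (oI n) => p _; exact: left_quotient_continuous.
  + apply/dense_left_quotient; apply: dense_subset dI.
    by rewrite irrE => z; apply.
  + by rewrite WE /= mulVg; exact: identity_not_irregular.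
  exists K; split => // x y Kx Ky xy.
  by rewrite LY_extremely_chaoticE//; have := KW x y Kx Ky xy; rewrite WE.
- move=> scrambled.
  have dI : dense (irregular d rho T).
    apply/dense_left_quotient; rewrite -LY_extremely_chaotic_relationE//.
    move=> Q Q0 oQ.
    have [U [V [oU oV U0 V0 UV]]] := open_setX_subset oQ Q0.
    have [||K [KC KO KS]] := scrambled (fun j => if j is 0%N then U else V).
    + by case.
    + by case.
    have [x Kx] : K 0%N !=set0.
      by have [x [_ [Kx _ _]]] := cantor_set_two_points (KC 0%N); exists x.
    have [y Ky xy] : exists2 y, K 1%N y & x <> y.
      have [y [z [Ky Kz yz]]] := cantor_set_two_points (KC 1%N).
      have [xy|xy] := pselect (x = y); last by exists y.
      by exists z => //; rewrite xy.
    exists (x, y); split; first by apply: UV; split; [exact: (KO 0%N)|exact: (KO 1%N)].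
    by apply: KS => //; [exists 0%N|exists 1%N].
  split; last exact: dense_irregular_sensitive.
  rewrite proximal_relationE//; apply/dense_left_quotient.
  by apply: dense_subset _ dI; rewrite irrE => z zI k _; have [] := zI k I.
- move=> [dP sens]; exists (irregular d rho T); split => //.
  exact: dense_irregular dP sens.
Qed.
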